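(* Let $G$ be a discrete group, let $B$ be a unital C$^*$-algebra, let $\psi:G\to\operatorname{Pic}(B)$ be a group homomorphism, and let $(B_g,\Psi_{g,h})_{g,h\in G}$ be a factor system for $\psi$. Let $\mathcal{B}:=\bigcup_{g\in G}B_g$ (disjoint union) and let $\pi:\mathcal{B}\to G$ be the canonical projection. Define a multiplication on $\mathcal{B}$ by $st:=m(s,t):=\Psi_{g,h}(s\otimes t)$ for $s\in B_g$, $t\in B_h$, $g,h\in G$, and define an involution on $\mathcal{B}$ by $s^*:=\lambda_s^*(1_B)\in B_{g^{-1}}$ for $s\in B_g$, $g\in G$, where $\lambda_s^*:B\to B_{g^{-1}}$ is the adjoint (with respect to the right $B$-valued inner products) of the adjointable map $\lambda_s:B_{g^{-1}}\to B$, $\lambda_s(t):=\Psi_{g,g^{-1}}(s\otimes t)$. Then, with this multiplication and involution, $\pi:\mathcal{B}\to G$ is a (discrete) saturated Fell bundle.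
   Context: A Morita equivalence $B$-bimodule is a $B$-$B$ imprimitivity bimodule, with left inner product ${}_B\langle\cdot,\cdot\rangle$ and right inner product $\langle\cdot,\cdot\rangle_B$, normed by $\|s\|^2=\|\langle s,s\rangle_B\|$; isomorphisms are $B$-bimodule isomorphisms preserving both inner products. $\operatorname{Pic}(B)$ is the group of isomorphism classes $[M]$ of Morita equivalence $B$-bimodules under the internal tensor product $\otimes_B$. A factor system for $\psi$ is a family $(B_g,\Psi_{g,h})_{g,h\in G}$, where each $B_g$ is a representative of $\psi(g)$, with $B_e:=B$, and each $\Psi_{g,h}:B_g\otimes_B B_h\to B_{gh}$ is an isomorphism of Morita equivalence $B$-bimodules, with $\Psi_{e,e}=\operatorname{id}_B$ (under the canonical identification $B\otimes_B B=B$), such that $\Psi_{gh,k}\circ(\Psi_{g,h}\otimes\operatorname{id}_k)=\Psi_{g,hk}\circ(\operatorname{id}_g\otimes\Psi_{h,k})$ for all $g,h,k\in G$. A discrete Fell bundle over a discrete group $G$ is a set $\mathcal{B}$ with a surjection $\pi:\mathcal{B}\to G$ whose fibers $B_g=\pi^{-1}(g)$ are complex Banach spaces, with an associative multiplication $\mathcal{B}\times\mathcal{B}\to\mathcal{B}$ and an involution ${}^*:\mathcal{B}\to\mathcal{B}$ such that: (F1) $B_gB_h\subseteq B_{gh}$ and the multiplication $B_g\times B_h\to B_{gh}$ is bilinear; (F2) $\|st\|\le\|s\|\|t\|$; (F3) $B_g^*\subseteq B_{g^{-1}}$ and ${}^*:B_g\to B_{g^{-1}}$ is antilinear; (F4)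 $(st)^*=t^*s^*$; (F5) $(s^* )^*=s$; (F6) $\|s^*s\|=\|s\|^2$; (F7) $s^*s\ge0$ in the C$^*$-algebra $B_e$ (no topological requirements). It is saturated if $\operatorname{span}\{B_gB_h\}$ is dense in $B_{gh}$ for all $g,h\in G$. *)

(* Defs.v *)
From HB Require Import structures.
From mathcomp Require Import all_boot all_order all_algebra.
From mathcomp Require Import all_classical all_reals all_analysis.
From mathcomp Require Import complex.

Set Implicit Arguments.
Unset Strict Implicit.
Unset Printing Implicit Defensive.

Import Order.TTheory GRing.Theory Num.Theory.
Import numFieldNormedType.Exports.

Local Open Scope classical_set_scope.
Local Open Scope ring_scope.
Local Open Scope complex_scope.

Definition lspan (K : pzRingType) (V : lmodType K) (A : set V) : set V :=
  [set x | exists l : seq (K * V),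
     (forall p, p \in l -> A p.2) /\ x = \sum_(p <- l) p.1 *: p.2].

(* Hierarchy-Builder does not allow a structure joining rings and normed
   modules, hence the bundled record; the ring structure is put on its carrier
   just below.  The zero algebra is allowed. *)
Record cstarAlgType (R : realType) := CStarAlg {
  cs_banach : completeNormedModType R[i];
  cs_one : cs_banach;
  cs_mul : cs_banach -> cs_banach -> cs_banach;
  cs_adj : cs_banach -> cs_banach;
  cs_mulA : associative cs_mul;
  cs_mul1l : left_id cs_one cs_mul;
  cs_mulr1 : right_id cs_one cs_mul;
  cs_mulDl : left_distributive cs_mul +%R;
  cs_mulDr : right_distributive cs_mul +%R;
  cs_scaleAl : forall (c : R[i]) a b, c *: cs_mul a b = cs_mul (c *: a) b;
  cs_scaleAr : forall (c : R[i]) a b, c *: cs_mul a b = cs_mul a (c *: b);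
  cs_normM : forall a b, `|cs_mul a b| <= `|a| * `|b|;
  cs_adjD : {morph cs_adj : a b / a + b};
  cs_adjZ : forall (c : R[i]) a, cs_adj (c *: a) = Num.conj c *: cs_adj a;
  cs_adjM : forall a b, cs_adj (cs_mul a b) = cs_mul (cs_adj b) (cs_adj a);
  cs_adjK : involutive cs_adj;
  cs_cstar : forall a, `|cs_mul (cs_adj a) a| = `|a| ^+ 2
}.

Definition cs_sort (R : realType) (A : cstarAlgType R) : Type := cs_banach A.
Coercion cs_sort : cstarAlgType >-> Sortclass.

HB.instance Definition _ (R : realType) (A : cstarAlgType R) :=
  CompleteNormedModule.copy (cs_sort A) (cs_banach A).
HB.instance Definition _ (R : realType) (A : cstarAlgType R) :=
  GRing.Zmodule_isPzRing.Build (cs_sort A)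
    (@cs_mulA R A) (@cs_mul1l R A) (@cs_mulr1 R A)
    (@cs_mulDl R A) (@cs_mulDr R A).

Section CStarAlg.
Variables (R : realType) (B : cstarAlgType R).
Implicit Types a b : B.

Definition cadj a : B := cs_adj a.
Definition cstar_ge0 a : Prop := exists b, a = cadj b * b.

Lemma cadjD : {morph cadj : a b / a + b}. Proof. exact: cs_adjD. Qed.
Lemma cadjZ (c : R[i]) a : cadj (c *: a) = Num.conj c *: cadj a.
Proof. exact: cs_adjZ. Qed.
Lemma cadj0 : cadj 0 = 0. Proof. by rewrite -(scale0r 0) cadjZ rmorph0 !scale0r. Qed.
Lemma cadjM a b : cadj (a * b) = cadj b * cadj a. Proof. exact: cs_adjM. Qed.
Lemma cadjK : involutive cadj. Proof. exact: cs_adjK. Qed.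
Lemma cadj1 : cadj 1 = 1.
Proof. by rewrite -[LHS]mulr1 -{2}[1]cadjK -cadjM mulr1 cadjK. Qed.
Lemma cnormM a b : `|a * b| <= `|a| * `|b|. Proof. exact: cs_normM. Qed.
Lemma cstarE a : `|cadj a * a| = `|a| ^+ 2. Proof. exact: cs_cstar. Qed.
Lemma cscaleAl (c : R[i]) a b : c *: (a * b) = (c *: a) * b.
Proof. exact: cs_scaleAl. Qed.
Lemma cscaleAr (c : R[i]) a b : c *: (a * b) = a * (c *: b).
Proof. exact: cs_scaleAr. Qed.

End CStarAlg.

(* The norm is the one of the right inner product.  The norm of the left inner
   product is equal to it, so completeness is required only once. *)
Record moritaBimod (R : realType) (B : cstarAlgType R) := MoritaBimod {
  mb_banach :> completeNormedModType R[i];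
  lact : B -> mb_banach -> mb_banach;
  ract : mb_banach -> B -> mb_banach;
  lip : mb_banach -> mb_banach -> B;
  rip : mb_banach -> mb_banach -> B;
  lactDl : forall a b x, lact (a + b) x = lact a x + lact b x;
  lactDr : forall a x y, lact a (x + y) = lact a x + lact a y;
  lactZl : forall (c : R[i]) a x, lact (c *: a) x = c *: lact a x;
  lactZr : forall (c : R[i]) a x, lact a (c *: x) = c *: lact a x;
  lactM : forall a b x, lact (a * b) x = lact a (lact b x);
  lact1 : forall x, lact 1 x = x;
  ractDl : forall x y b, ract (x + y) b = ract x b + ract y b;
  ractDr : forall x a b, ract x (a + b) = ract x a + ract x b;
  ractZl : forall (c : R[i]) x b, ract (c *: x) b = c *: ract x b;
  ractZr : forall (c : R[i]) x b, ract x (c *: b) = c *: ract x b;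
  ractM : forall x a b, ract x (a * b) = ract (ract x a) b;
  ract1 : forall x, ract x 1 = x;
  lractA : forall a x b, lact a (ract x b) = ract (lact a x) b;
  ripDr : forall x y z, rip x (y + z) = rip x y + rip x z;
  ripZr : forall (c : R[i]) x y, rip x (c *: y) = c *: rip x y;
  rip_ract : forall x y b, rip x (ract y b) = rip x y * b;
  rip_adj : forall x y, cadj (rip x y) = rip y x;
  rip_ge0 : forall x, cstar_ge0 (rip x x);
  rip_norm : forall x, `|x| ^+ 2 = `|rip x x|;
  rip_full : dense (lspan [set b | exists x y, b = rip x y]);
  lipDl : forall x y z, lip (x + y) z = lip x z + lip y z;
  lipZl : forall (c : R[i]) x y, lip (c *: x) y = c *: lip x y;
  lip_lact : forall a x y, lip (lact a x) y = a * lip x y;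
  lip_adj : forall x y, cadj (lip x y) = lip y x;
  lip_ge0 : forall x, cstar_ge0 (lip x x);
  lip_eq0 : forall x, lip x x = 0 -> x = 0;
  lip_full : dense (lspan [set b | exists x y, b = lip x y]);
  rip_lact : forall a x y, rip (lact a x) y = rip x (lact (cadj a) y);
  lip_ract : forall x y b, lip (ract x b) y = lip x (ract y (cadj b));
  lip_rip : forall x y z, lact (lip x y) z = ract x (rip y z)
}.

Record bimodIso (R : realType) (B : cstarAlgType R) (M N : moritaBimod B) :=
  BimodIso {
  iso_fun :> M -> N;
  isoD : {morph iso_fun : x y / x + y};
  isoZ : forall (c : R[i]) x, iso_fun (c *: x) = c *: iso_fun x;
  iso_lact : forall b x, iso_fun (lact b x) = lact b (iso_fun x);
  iso_ract : forall x b, iso_fun (ract x b) = ract (iso_fun x) b;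
  iso_lip : forall x y, lip (iso_fun x) (iso_fun y) = lip x y;
  iso_rip : forall x y, rip (iso_fun x) (iso_fun y) = rip x y;
  iso_bij : bijective iso_fun
}.

Section Bimod.
Variables (R : realType) (B : cstarAlgType R).
Implicit Types M N P : moritaBimod B.

Definition iso_id M : bimodIso M M.
Proof. by exists id => //; exists id. Defined.

Definition iso_of_eq M N (e : M = N) : bimodIso M N :=
  match e in _ = N' return bimodIso M N' with erefl => iso_id M end.

Lemma lspan_id (V : lmodType R[i]) (A : set V) : A `<=` lspan A.
Proof.
move=> x Ax; exists [:: (1, x)]; split=> [p|]; first by rewrite inE => /eqP->.
by rewrite big_seq1 scale1r.
Qed.

Lemma dense_setT (T : topologicalType) (A : set T) : A = setT -> dense A.
Proof. by move=> -> O O0 _; rewrite setIT. Qed.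

Lemma csort_eq0 (b : B) : cadj b * b = 0 -> b = 0.
Proof.
move=> h; have := cstarE b; rewrite h normr0 => /esym/eqP.
by rewrite sqrf_eq0 => /eqP/normr0_eq0.
Qed.

Definition regularBimod : moritaBimod B.
Proof.
refine (@MoritaBimod R B (cs_sort B) (fun a b : B => a * b) (fun a b : B => a * b)
  (fun a b : B => a * cadj b) (fun a b : B => cadj a * b)
  _ _ _ _ _ _ _ _ _ _ _ _ _ _ _ _ _ _ _ _ _ _ _ _ _ _ _ _ _ _).
- exact: mulrDl.
- exact: mulrDr.
- by move=> c a x; rewrite cscaleAl.
- by move=> c a x; rewrite cscaleAr.
- by move=> a b x; rewrite mulrA.
- exact: mul1r.
- exact: mulrDl.
- exact: mulrDr.
- by move=> c a x; rewrite cscaleAl.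
- by move=> c a x; rewrite cscaleAr.
- by move=> a b x; rewrite mulrA.
- exact: mulr1.
- by move=> a x b; rewrite mulrA.
- by move=> x y z; rewrite mulrDr.
- by move=> c x y; rewrite cscaleAr.
- by move=> x y b; rewrite mulrA.
- by move=> x y; rewrite cadjM cadjK.
- by move=> x; exists x.
- by move=> x; rewrite cstarE.
- apply/dense_setT/seteqP; split=> // b _; apply: lspan_id.
  by exists 1, b; rewrite cadj1 mul1r.
- by move=> x y z; rewrite mulrDl.
- by move=> c x y; rewrite cscaleAl.
- by move=> a x y; rewrite mulrA.
- by move=> x y; rewrite cadjM cadjK.
- by move=> x; exists (cadj x); rewrite cadjK.
- move=> x xx0; have h : cadj x = 0 by apply: csort_eq0; rewrite cadjK.
  by rewrite -[x](@cadjK R B) h cadj0.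
- apply/dense_setT/seteqP; split=> // b _; apply: lspan_id.
  by exists b, 1; rewrite cadj1 mulr1.
- by move=> a x y; rewrite cadjM mulrA.
- by move=> x y b; rewrite cadjM cadjK mulrA.
- by move=> x y z; rewrite mulrA.
Defined.

End Bimod.

Arguments regularBimod {R} B.

(* The internal tensor product of [M] and [N]: the completion of the algebraic
   B-balanced tensor product for the inner products below, i.e. a bimodule
   together with a balanced bilinear map whose range has dense span. *)
Record internalTensor (R : realType) (B : cstarAlgType R)
    (M N : moritaBimod B) := InternalTensor {
  it_bimod :> moritaBimod B;
  tens : M -> N -> it_bimod;
  tensDl : forall x x' y, tens (x + x') y = tens x y + tens x' y;
  tensDr : forall x y y', tens x (y + y') = tens x y + tens x y';
  tensZl : forall (c : R[i]) x y, tens (c *: x) y = c *: tens x y;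
  tensZr : forall (c : R[i]) x y, tens x (c *: y) = c *: tens x y;
  tens_bal : forall x b y, tens (ract x b) y = tens x (lact b y);
  tens_lact : forall b x y, lact b (tens x y) = tens (lact b x) y;
  tens_ract : forall x y b, ract (tens x y) b = tens x (ract y b);
  tens_lip : forall x y x' y',
    lip (tens x y) (tens x' y') = lip (ract x (lip y y')) x';
  tens_rip : forall x y x' y',
    rip (tens x y) (tens x' y') = rip y (lact (rip x x') y');
  tens_dense : dense (lspan [set z | exists x y, z = tens x y])
}.

Section Neumann.
Variables (R : realType) (B : cstarAlgType R).

Lemma complex_ge0_ex (z : R[i]) : 0 <= z -> exists2 r : R, 0 <= r & z = r%:C.
Proof.
case: z => a b; rewrite lecE /= => /andP[/eqP -> a0]; by exists a.
Qed.

Lemma cnorm1 : `|1 : B| <= 1.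
Proof.
have /eqP := cstarE (1 : B); rewrite cadj1 mulr1 expr2 -subr_eq0.
rewrite -[X in X - _]mulr1 -mulrBr mulf_eq0 => /orP[/eqP->//|].
by rewrite subr_eq0 => /eqP <-.
Qed.

Lemma cnormX (x : B) n : `|x ^+ n| <= `|x| ^+ n.
Proof.
elim: n => [|n IH]; first by rewrite !expr0 cnorm1.
rewrite !exprS; apply: (le_trans (cnormM _ _)).
by apply: ler_wpM2l.
Qed.

Lemma sum_exprB (x : B) n : (\sum_(0 <= k < n) x ^+ k) * (1 - x) = 1 - x ^+ n.
Proof.
elim: n => [|n IH]; first by rewrite big_geq// mul0r expr0 subrr.
rewrite big_nat_recr//= mulrDl IH mulrBr mulr1 -exprSr.
by rewrite addrA subrK.
Qed.

Lemma neumann (a : B) : `|1 - a| < 1 -> exists b : B, b * a = 1.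
Proof.
set x := 1 - a => x1.
have [r r0 xr] := complex_ge0_ex (normr_ge0 x).
have r1 : `|r| < 1 by rewrite ger0_norm// -ltcR -xr.
have small (e : R[i]) : 0 < e -> exists2 d : R, 0 < d & e = d%:C.
  move=> e0; have [d _ ed] := complex_ge0_ex (ltW e0).
  by exists d => //; rewrite -ltcR -ed.
have cs : cvgn (series (fun k => x ^+ k)).
  apply/cauchy_cvgP/cauchy_seriesP => e /small[d d0 ->].
  have /cauchy_cvgP/cauchy_seriesP/(_ _ d0) := @is_cvg_geometric_series R 1 r r1.
  apply: filterS => n; rewrite -ltcR; apply: le_lt_trans.
  apply: (le_trans (ler_norm_sum _ _ _)).
  rewrite ger0_norm; last first.
    by apply: sumr_ge0 => k _; rewrite /= mul1r exprn_ge0.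
  rewrite rmorph_sum /=; apply: ler_sum => k _.
  by rewrite mul1r rmorphXn /= -xr cnormX.
exists (limn (series (fun k => x ^+ k))).
set b := limn _.
have ax : a = 1 - x by rewrite /x opprB addrC subrK.
apply/eqP; rewrite -subr_eq0 -normr_eq0; apply: contraT => h.
have {h} : 0 < `|b * a - 1| by rewrite lt_neqAle eq_sym h normr_ge0.
set e := `|_ - _| => e0.
have e20 : 0 < e / 2 by rewrite divr_gt0.
have [d d0 ed] := small _ e20.
have k0 : 0 < `|a| + 1 by apply: ltr_wpDl.
have ek0 : 0 < (e / 2) / (`|a| + 1) by rewrite divr_gt0.
have /cvgrPdist_lt/(_ _ ek0) bn := cs.
have /cvgrPdist_lt/(_ _ d0) rn := @cvg_geometric R 1 r r1.
have [n [/= h1 h2]] := @filter_ex _ _ _ _ (filterI bn rn).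
suff : e < e by rewrite ltxx.
rewrite {1}/e -[b * a - 1](subrK (series (fun k => x ^+ k) n * a)).
have -> : b * a - 1 - series (fun k => x ^+ k) n * a
  + series (fun k => x ^+ k) n * a =
  (b - series (fun k => x ^+ k) n) * a - x ^+ n.
  have sa : series (fun k => x ^+ k) n * a = 1 - x ^+ n by rewrite {1}ax sum_exprB.
  by rewrite subrK mulrBl sa opprB [x ^+ n - 1]addrC addrA addrK.
rewrite (le_lt_trans (ler_normB _ _))// [ltRHS](splitr e) ltr_leD//.
  rewrite (le_lt_trans (cnormM _ _))//.
  rewrite (@le_lt_trans _ _ (`|b - series (fun k => x ^+ k) n| * (`|a| + 1)))//.
    by apply: ler_wpM2l => //; rewrite lerDl.
  by rewrite -ltr_pdivlMr.
rewrite (le_trans (cnormX _ _))// ed xr -rmorphXn lecR.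
by move: h2; rewrite sub0r normrN mul1r => /ltW; apply: le_trans; rewrite ler_norm.
Qed.

End Neumann.

Section Span.
Variables (K : pzRingType) (V : lmodType K).
Implicit Types A : set V.

Lemma lspan0 A : lspan A 0.
Proof. by exists [::]; split=> //; rewrite big_nil. Qed.

Lemma lspanD A x y : lspan A x -> lspan A y -> lspan A (x + y).
Proof.
move=> [l [lA ->]] [l' [lA' ->]]; exists (l ++ l'); rewrite big_cat; split=> // p.
by rewrite mem_cat => /orP[/lA|/lA'].
Qed.

Lemma lspanZ A (c : K) x : lspan A x -> lspan A (c *: x).
Proof.
move=> [l [lA ->]]; exists [seq (c * p.1, p.2) | p <- l]; split.
  by move=> _ /mapP[p /lA Ap ->].
by rewrite scaler_sumr big_map; apply: eq_bigr => p _; rewrite scalerA.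
Qed.

Lemma lspan_ind A (P : V -> Prop) :
  P 0 -> (forall x y, P x -> P y -> P (x + y)) ->
  (forall (c : K) x, A x -> P (c *: x)) -> forall x, lspan A x -> P x.
Proof.
move=> P0 PD PZ _ [l [lA ->]]; elim: l lA => [|p l IH] lA; first by rewrite big_nil.
rewrite big_cons; apply: PD; first by apply/PZ/lA; rewrite mem_head.
by apply: IH => q ql; apply: lA; rewrite inE ql orbT.
Qed.

Lemma lspan_incl A A' : A `<=` lspan A' -> lspan A `<=` lspan A'.
Proof.
move=> AA'; apply: (lspan_ind (P := lspan A')).
- exact: lspan0.
- by move=> x y; apply: lspanD.
- by move=> c x /AA'; apply: lspanZ.
Qed.

End Span.

Lemma lspan_map (K : pzRingType) (V W : lmodType K) (A : set V) (A' : set W)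
  (f : V -> W) :
  {morph f : x y / x + y} -> (forall (c : K) x, f (c *: x) = c *: f x) ->
  (forall x, A x -> lspan A' (f x)) -> forall x, lspan A x -> lspan A' (f x).
Proof.
move=> fD fZ fA; apply: (lspan_ind (P := fun x => lspan A' (f x))).
- by rewrite -(scale0r (0 : V)) fZ scale0r; apply: lspan0.
- by move=> x y ? ?; rewrite fD; apply: lspanD.
- by move=> c x /fA; rewrite fZ; apply: lspanZ.
Qed.

Lemma subset_dense (T : topologicalType) (A A' : set T) :
  A `<=` A' -> dense A -> dense A'.
Proof. by move=> AA' dA O O0 oO; have [x [Ox /AA' Ax]] := dA O O0 oO; exists x. Qed.

Section BimodTheory.
Variables (R : realType) (B : cstarAlgType R).
Implicit Types M N P : moritaBimod B.

Lemma dense_ideal1 (A : set B) :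
  (forall a b, A b -> A (a * b)) -> dense (lspan A) -> lspan A 1.
Proof.
move=> AM dA; have [||a [ya Aa]] := dA (ball (1 : B) 1).
- by exists 1; apply: ballxx.
- exact: ball_open.
have [b <-] : exists b : B, b * a = 1.
  by apply: neumann; move: ya; rewrite -ball_normE.
move: Aa; apply: lspan_map => [x y|c x|x Ax].
- exact: mulrDr.
- by rewrite cscaleAr.
- by apply/lspan_id/AM.
Qed.

Lemma ripDl M (x y z : M) : rip (x + y) z = rip x z + rip y z.
Proof. by rewrite -rip_adj ripDr cadjD !rip_adj. Qed.

Lemma ripZl M (c : R[i]) (x y : M) : rip (c *: x) y = Num.conj c *: rip x y.
Proof. by rewrite -rip_adj ripZr cadjZ rip_adj. Qed.

Lemma rip_ractl M (x y : M) b : rip (ract x b) y = cadj b * rip x y.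
Proof. by rewrite -rip_adj rip_ract cadjM rip_adj. Qed.

Lemma lipDr M (x y z : M) : lip x (y + z) = lip x y + lip x z.
Proof. by rewrite -lip_adj lipDl cadjD !lip_adj. Qed.

Lemma lipZr M (c : R[i]) (x y : M) : lip x (c *: y) = Num.conj c *: lip x y.
Proof. by rewrite -lip_adj lipZl cadjZ lip_adj. Qed.

Lemma rip_eq0 M (x : M) : rip x x = 0 -> x = 0.
Proof.
move=> h; have := rip_norm x; rewrite h normr0 => /eqP.
by rewrite sqrf_eq0 => /eqP/normr0_eq0.
Qed.

Lemma lip_ideal M (a b : B) :
  [set c | exists x y : M, c = lip x y] b ->
  [set c | exists x y : M, c = lip x y] (a * b).
Proof. by move=> [x [y ->]]; exists (lact a x), y; rewrite lip_lact. Qed.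

Lemma lip_full1 M : lspan [set b | exists x y : M, b = lip x y] 1.
Proof. by apply: dense_ideal1; [exact: lip_ideal|exact: lip_full]. Qed.

Lemma lspan_full M (U : set M) :
  (forall b x, U x -> U (lact b x)) -> (forall x b, U x -> U (ract x b)) ->
  dense (lspan [set b | exists x y, [/\ U x, U y & b = lip x y]]) ->
  lspan U = setT.
Proof.
move=> Ul Ur dU; apply/seteqP; split=> // x _; rewrite -[x]lact1.
have: lspan [set b | exists x y, [/\ U x, U y & b = lip x y]] 1.
  apply: dense_ideal1 dU => a _ [y [z [Uy Uz ->]]].
  by exists (lact a y), z; rewrite lip_lact; split=> //; apply: Ul.
apply: (lspan_map (f := fun b => lact b x)) => [a b|c a|_ [y [z [Uy Uz ->]]]].
- exact: lactDl.
- exact: lactZl.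
- by rewrite lip_rip; apply/lspan_id/Ur.
Qed.

Lemma lspan_tens M N (T : internalTensor M N) :
  lspan [set z : T | exists x y, z = tens T x y] = setT.
Proof.
apply: lspan_full.
- by move=> b _ [x [y ->]]; exists (lact b x), y; rewrite tens_lact.
- by move=> _ b [x [y ->]]; exists x, (ract y b); rewrite tens_ract.
apply: subset_dense (@lip_full R B M).
apply: lspan_incl => _ [x [x' ->]]; rewrite -[x]ract1.
have := lip_full1 N; apply: (lspan_map (f := fun b => lip (ract x b) x')).
- by move=> a b; rewrite ractDr lipDl.
- by move=> c a; rewrite ractZr lipZl.
move=> _ [y [y' ->]]; apply: lspan_id.
exists (tens T x y), (tens T x' y'); split; last by rewrite tens_lip.
- by exists x, y.
- by exists x', y'.
Qed.

Section Extension.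
Variables (M N : moritaBimod B) (I : Type) (u : I -> M) (w : I -> N).
Hypotheses (u_span : lspan (range u) = setT) (w_span : lspan (range w) = setT).
Hypothesis uw_lip : forall i j, lip (u i) (u j) = lip (w i) (w j).
Hypothesis uw_rip : forall i j, rip (u i) (u j) = rip (w i) (w j).

Let comb (X : moritaBimod B) (v : I -> X) (l : seq (R[i] * I)) : X :=
  \sum_(p <- l) p.1 *: v p.2.

Let combP (X : moritaBimod B) (v : I -> X) (x : X) : lspan (range v) = setT ->
  exists l, x = comb v l.
Proof.
move=> vT; have : lspan (range v) x by rewrite vT.
move: x; apply: lspan_ind => [|_ _ [l ->] [l' ->]|c _ [i _ <-]].
- by exists [::]; rewrite /comb big_nil.
- by exists (l ++ l'); rewrite /comb big_cat.
- by exists [:: (c, i)]; rewrite /comb big_seq1.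
Qed.

Let rip0r (X : moritaBimod B) (x : X) : rip x 0 = 0.
Proof. by rewrite -(scale0r 0) ripZr !scale0r. Qed.
Let rip0l (X : moritaBimod B) (x : X) : rip 0 x = 0.
Proof. by rewrite -rip_adj rip0r cadj0. Qed.
Let lip0l (X : moritaBimod B) (x : X) : lip 0 x = 0.
Proof. by rewrite -(scale0r 0) lipZl !scale0r. Qed.
Let lip0r (X : moritaBimod B) (x : X) : lip x 0 = 0.
Proof. by rewrite -lip_adj lip0l cadj0. Qed.

Let rip_comb l l' : rip (comb u l) (comb u l') = rip (comb w l) (comb w l').
Proof.
rewrite /comb; elim: l => [|p l IH]; first by rewrite !big_nil !rip0l.
rewrite !big_cons !ripDl IH !ripZl; congr (_ *: _ + _).
elim: l' {IH} => [|q l' IH]; first by rewrite !big_nil !rip0r.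
by rewrite !big_cons !ripDr IH !ripZr uw_rip.
Qed.

Let lip_comb l l' : lip (comb u l) (comb u l') = lip (comb w l) (comb w l').
Proof.
rewrite /comb; elim: l => [|p l IH]; first by rewrite !big_nil !lip0l.
rewrite !big_cons !lipDl IH !lipZl; congr (_ *: _ + _).
elim: l' {IH} => [|q l' IH]; first by rewrite !big_nil !lip0r.
by rewrite !big_cons !lipDr IH !lipZr uw_lip.
Qed.

Let rip_inj (X : moritaBimod B) (x y : X) :
  (forall z, rip x z = rip y z) -> x = y.
Proof.
move=> h; apply/eqP; rewrite -subr_eq0; apply/eqP/rip_eq0.
by rewrite ripDl -scaleN1r ripZl rmorphN1 !scaleN1r h subrr.
Qed.

Lemma iso_ext_subproof : exists F : bimodIso M N, forall i, F (u i) = w i.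
Proof.
have [lu luE] := choice (fun x => combP x u_span).
have [lw lwE] := choice (fun x => combP x w_span).
pose F x := comb w (lu x); pose G y := comb u (lw y).
have Frip x y : rip (F x) (F y) = rip x y by rewrite [x]luE [y]luE -rip_comb -!luE.
have Frip_w x l : rip (F x) (comb w l) = rip x (comb u l).
  by rewrite -rip_comb -luE.
have Fcomb l : F (comb u l) = comb w l.
  by apply: rip_inj => z; rewrite [z]lwE Frip_w rip_comb.
have GK : cancel G F by move=> y; rewrite Fcomb -lwE.
have FE x y : (forall z, rip x (G z) = rip y z) -> F x = y.
  by move=> h; apply: rip_inj => z; rewrite -h -{1}[z]GK Frip.
have FG x z : rip (F x) z = rip x (G z) by rewrite -Frip GK.
have FK : cancel F G.
  by move=> x; apply: rip_inj => z; rewrite -Frip GK Frip.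
have FD : {morph F : x y / x + y}.
  by move=> x y; apply: FE => z; rewrite !ripDl !FG.
have FZ (c : R[i]) x : F (c *: x) = c *: F x.
  by apply: FE => z; rewrite !ripZl !FG.
have Fract x b : F (ract x b) = ract (F x) b.
  by apply: FE => z; rewrite !rip_ractl !FG.
have Flip x y : lip (F x) (F y) = lip x y.
  by rewrite [in RHS](luE x) [in RHS](luE y) lip_comb.
have Flact b x : F (lact b x) = lact b (F x).
  have : lspan [set b | exists x y : M, b = lip x y] b.
    rewrite -[b]mulr1; have := lip_full1 M.
    apply: (lspan_map (f := fun a => b * a)) => [a c|c a|a La].
    - exact: mulrDr.
    - by rewrite cscaleAr.
    - exact/lspan_id/lip_ideal.
  move: b; apply: lspan_ind => [|a b IHa IHb|c _ [y [z ->]]].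
  - by rewrite -(scale0r 0) !lactZl !scale0r -(scale0r 0) FZ scale0r.
  - by rewrite !lactDl FD IHa IHb.
  - by rewrite !lactZl FZ lip_rip Fract -Frip -lip_rip Flip.
exists (BimodIso FD FZ Flact Fract Flip Frip (Bijective FK GK)) => i /=.
have -> : u i = comb u [:: (1, i)] by rewrite /comb big_seq1 scale1r.
by rewrite Fcomb /comb big_seq1 scale1r.
Qed.

Definition iso_ext : bimodIso M N := sval (cid iso_ext_subproof).

Lemma iso_extE i : iso_ext (u i) = w i.
Proof. exact: (svalP (cid iso_ext_subproof)). Qed.

End Extension.

Definition iso_comp M N P (f : bimodIso N P) (g : bimodIso M N) : bimodIso M P.
Proof.
exists (fun x => f (g x)).
- by move=> x y; rewrite !isoD.
- by move=> c x; rewrite !isoZ.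
- by move=> b x; rewrite !iso_lact.
- by move=> x b; rewrite !iso_ract.
- by move=> x y; rewrite !iso_lip.
- by move=> x y; rewrite !iso_rip.
- exact: (bij_comp (iso_bij f) (iso_bij g)).
Defined.

Lemma iso_inv M N : bimodIso M N -> inhabited (bimodIso N M).
Proof.
move=> f; have [g fK gK] := iso_bij f; split; exists g.
- by move=> x y; rewrite -{1}[x]gK -{1}[y]gK -isoD fK.
- by move=> c x; rewrite -{1}[x]gK -isoZ fK.
- by move=> b x; rewrite -{1}[x]gK -iso_lact fK.
- by move=> x b; rewrite -{1}[x]gK -iso_ract fK.
- by move=> x y; rewrite -(iso_lip f) !gK.
- by move=> x y; rewrite -(iso_rip f) !gK.
- by exists f.
Qed.

Definition tens_pair M N (T : internalTensor M N) (p : M * N) : T :=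
  tens T p.1 p.2.

Lemma tens_pair_span M N (T : internalTensor M N) :
  lspan (range (tens_pair T)) = setT.
Proof.
rewrite -(lspan_tens T); congr lspan; apply/seteqP; split=> [_ [p _ <-]|].
  by exists p.1, p.2.
by move=> _ [x [y ->]]; exists (x, y).
Qed.

Section TensorIso.
Variables (M N M' N' : moritaBimod B).
Variables (T : internalTensor M N) (T' : internalTensor M' N').
Variables (f : bimodIso M M') (g : bimodIso N N').

Let w (p : M * N) : T' := tens T' (f p.1) (g p.2).

Lemma tens_iso_span : lspan (range w) = setT.
Proof.
rewrite -(tens_pair_span T'); congr lspan; apply/seteqP; split=> _ [[x y] _ <-].
  by exists (f x, g y).
have [f' _ fK] := iso_bij f; have [g' _ gK] := iso_bij g.
by exists (f' x, g' y) => //; rewrite /w /= fK gK.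
Qed.

Lemma tens_iso_lip p q : lip (tens_pair T p) (tens_pair T q) = lip (w p) (w q).
Proof. by rewrite !tens_lip iso_lip -iso_ract iso_lip. Qed.

Lemma tens_iso_rip p q : rip (tens_pair T p) (tens_pair T q) = rip (w p) (w q).
Proof. by rewrite !tens_rip iso_rip -iso_lact iso_rip. Qed.

Definition tens_iso : bimodIso T T' :=
  iso_ext (tens_pair_span T) tens_iso_span tens_iso_lip tens_iso_rip.

Lemma tens_isoE x y : tens_iso (tens T x y) = tens T' (f x) (g y).
Proof. exact: (iso_extE _ _ _ _ (x, y)). Qed.

End TensorIso.

Section TensorAssoc.
Variables (M N P : moritaBimod B).
Variables (MN : internalTensor M N) (MN_P : internalTensor MN P).
Variables (NP : internalTensor N P) (M_NP : internalTensor M NP).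

Let u (p : M * N * P) : MN_P := tens MN_P (tens MN p.1.1 p.1.2) p.2.
Let w (p : M * N * P) : M_NP := tens M_NP p.1.1 (tens NP p.1.2 p.2).

Lemma tens_assoc_spanl : lspan (range u) = setT.
Proof.
apply/seteqP; split=> // z _; have: lspan (range (tens_pair MN_P)) z.
  by rewrite tens_pair_span.
move: z; apply: lspan_incl => _ [[x p] _ <-]; rewrite /tens_pair /=.
have: lspan (range (tens_pair MN)) x by rewrite tens_pair_span.
apply: (lspan_map (f := fun x => tens MN_P x p)) => [a b|c a|_ [[m n] _ <-]].
- exact: tensDl.
- exact: tensZl.
- by apply: lspan_id; exists (m, n, p).
Qed.

Lemma tens_assoc_spanr : lspan (range w) = setT.
Proof.
apply/seteqP; split=> // z _; have: lspan (range (tens_pair M_NP)) z.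
  by rewrite tens_pair_span.
move: z; apply: lspan_incl => _ [[m x] _ <-]; rewrite /tens_pair /=.
have: lspan (range (tens_pair NP)) x by rewrite tens_pair_span.
apply: (lspan_map (f := fun x => tens M_NP m x)) => [a b|c a|_ [[n p] _ <-]].
- exact: tensDr.
- exact: tensZr.
- by apply: lspan_id; exists (m, n, p).
Qed.

Lemma tens_assoc_lip p q : lip (u p) (u q) = lip (w p) (w q).
Proof. by rewrite !tens_lip tens_ract tens_lip. Qed.

Lemma tens_assoc_rip p q : rip (u p) (u q) = rip (w p) (w q).
Proof. by rewrite !tens_rip tens_lact tens_rip. Qed.

Definition tens_assoc : bimodIso MN_P M_NP :=
  iso_ext tens_assoc_spanl tens_assoc_spanr tens_assoc_lip tens_assoc_rip.

Lemma tens_assocE x y z :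
  tens_assoc (tens MN_P (tens MN x y) z) = tens M_NP x (tens NP y z).
Proof. exact: (iso_extE _ _ _ _ (x, y, z)). Qed.

End TensorAssoc.

Section TensorUnit.
Variable T : internalTensor (regularBimod B) (regularBimod B).

Let w (p : regularBimod B * regularBimod B) : regularBimod B :=
  (p.1 : B) * (p.2 : B).

Lemma tens_unit_span : lspan (range w) = setT.
Proof.
apply/seteqP; split=> // b _; apply: lspan_id.
by exists (b, 1 : B) => //; apply: mulr1.
Qed.

Lemma tens_unit_lip p q : lip (tens_pair T p) (tens_pair T q) = lip (w p) (w q).
Proof. by rewrite tens_lip /= cadjM !mulrA. Qed.

Lemma tens_unit_rip p q : rip (tens_pair T p) (tens_pair T q) = rip (w p) (w q).
Proof. by rewrite tens_rip /= cadjM !mulrA. Qed.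

Definition tens_unit : bimodIso T (regularBimod B) :=
  iso_ext (tens_pair_span T) tens_unit_span tens_unit_lip tens_unit_rip.

Lemma tens_unitE (a b : B) : tens_unit (tens T a b) = a * b :> B.
Proof.
exact: (iso_extE (tens_pair_span T) tens_unit_span tens_unit_lip tens_unit_rip (a, b)).
Qed.

End TensorUnit.

End BimodTheory.

(* A choice of internal tensor product for all pairs of bimodules; it is unique
   up to isomorphism by [tens_iso], and exists by completion. *)
Definition tensorProduct (R : realType) (B : cstarAlgType R) :=
  forall M N : moritaBimod B, internalTensor M N.

Section Pic.
Variables (R : realType) (B : cstarAlgType R).
Implicit Types M N : moritaBimod B.

Definition isoClass M : moritaBimod B -> Prop :=
  fun N => inhabited (bimodIso M N).

Record Pic := MkPic {
  pic_class : moritaBimod B -> Prop;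
  pic_classP : exists M, pic_class = isoClass M
}.

Definition picClass M : Pic := MkPic (ex_intro _ M erefl).

Lemma pic_inj (c d : Pic) : pic_class c = pic_class d -> c = d.
Proof.
case: c d => [c cP] [d dP] /= cd; case: _ / cd in dP *.
by rewrite (Prop_irrelevance cP dP).
Qed.

Lemma picClassP M N : picClass M = picClass N <-> inhabited (bimodIso M N).
Proof.
split=> [[MN]|[f]].
  have : isoClass N N by split; exact: iso_id.
  by rewrite -MN.
have [f'] := iso_inv f.
apply: pic_inj; apply/funext => P; apply/propext; split=> -[g]; split.
  exact: iso_comp g f'.
exact: iso_comp g f.
Qed.

Definition picRepr (c : Pic) : moritaBimod B := sval (cid (pic_classP c)).

Lemma picReprK c : picClass (picRepr c) = c.
Proof. by apply: pic_inj; rewrite /= -(svalP (cid (pic_classP c))). Qed.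

Variable tp : tensorProduct B.

Definition picOne : Pic := picClass (regularBimod B).
Definition picMul (c d : Pic) : Pic := picClass (tp (picRepr c) (picRepr d)).

Lemma picMulE M N : picMul (picClass M) (picClass N) = picClass (tp M N).
Proof.
have /picClassP[f] := picReprK (picClass M).
have /picClassP[g] := picReprK (picClass N).
by apply/picClassP; split; exact: tens_iso f g.
Qed.

End Pic.

Section FactorSystem.
Variables (R : realType) (G : groupType) (B : cstarAlgType R).
Variable tp : tensorProduct B.

Definition isPicHom (psi : G -> Pic B) : Prop :=
  psi 1%g = picOne B /\
  forall g h, psi (g * h)%g = picMul tp (psi g) (psi h).

(* Transport along equalities of indices and along B_e = B is done by [iso_of_eq]. *)
Record factorSystem (psi : G -> Pic B) := FactorSystem {
  fs_bimod :> G -> moritaBimod B;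
  fs_repr : forall g, picClass (fs_bimod g) = psi g;
  fs_unit : fs_bimod 1%g = regularBimod B;
  fs_iso : forall g h, bimodIso (tp (fs_bimod g) (fs_bimod h)) (fs_bimod (g * h)%g);
  fs_iso11 : forall x : tp (fs_bimod 1%g) (fs_bimod 1%g),
    iso_of_eq fs_unit (iso_of_eq (congr1 fs_bimod (mul1g 1%g)) (fs_iso 1%g 1%g x)) =
    tens_unit (tp (regularBimod B) (regularBimod B))
      (tens_iso (tp (fs_bimod 1%g) (fs_bimod 1%g)) (tp (regularBimod B) (regularBimod B))
         (iso_of_eq fs_unit) (iso_of_eq fs_unit) x);
  fs_cocycle : forall g h k
      (x : tp (tp (fs_bimod g) (fs_bimod h)) (fs_bimod k)),
    fs_iso (g * h)%g k
      (tens_iso (tp (tp (fs_bimod g) (fs_bimod h)) (fs_bimod k))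
         (tp (fs_bimod (g * h)%g) (fs_bimod k))
         (fs_iso g h) (iso_id (fs_bimod k)) x) =
    iso_of_eq (congr1 fs_bimod (mulgA g h k))
      (fs_iso g (h * k)%g
        (tens_iso (tp (fs_bimod g) (tp (fs_bimod h) (fs_bimod k)))
           (tp (fs_bimod g) (fs_bimod (h * k)%g))
           (iso_id (fs_bimod g)) (fs_iso h k)
           (tens_assoc (tp (tp (fs_bimod g) (fs_bimod h)) (fs_bimod k))
              (tp (fs_bimod g) (tp (fs_bimod h) (fs_bimod k))) x)))
}.

End FactorSystem.

Section Adjoint.
Variables (R : realType) (B : cstarAlgType R) (M N : moritaBimod B).

Definition adjointable (f : M -> N) : Prop :=
  exists f' : N -> M, forall x y, rip (f x) y = rip x (f' y).

(* For adjointable [f] there is exactly one such [z], namely the value at [y] of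
   the adjoint of [f]. *)
Definition adjoint (f : M -> N) (y : N) : M :=
  xget 0 [set z | forall x, rip (f x) y = rip x z].

End Adjoint.

(* The set of a Fell bundle over [G] is the disjoint union [{g & E g}] of its
   fibers, with [projT1] as the projection.  The inclusions of E g E h in E (g h)
   and of (E g)^* in E g^-1 are contained in the types of [mul] and [star];
   identities between elements of
   fibers over different expressions for the same index hold in [{g & E g}]. *)
Section FellBundle.
Variables (R : realType) (G : groupType) (E : G -> completeNormedModType R[i]).
Variables (mul : forall g h, E g -> E h -> E (g * h)%g).
Variables (star : forall g, E g -> E g^-1%g).
Arguments mul {g h}.
Arguments star {g}.

Definition totalMul (x y : {g & E g}) : {g & E g} :=
  existT _ (projT1 x * projT1 y)%g (mul (projT2 x) (projT2 y)).

Definition totalStar (x : {g & E g}) : {g & E g} :=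
  existT _ (projT1 x)^-1%g (star (projT2 x)).

(* In the C*-algebra E 1, an element is positive if and only if it is of the
   form b^* b; this also holds without a unit. *)
Record isFellBundle : Prop := IsFellBundle {
  fell_mulA : associative totalMul;
  fell_mulDl : forall g h (s s' : E g) (t : E h),
    mul (s + s') t = mul s t + mul s' t;
  fell_mulDr : forall g h (s : E g) (t t' : E h),
    mul s (t + t') = mul s t + mul s t';
  fell_mulZl : forall g h (c : R[i]) (s : E g) (t : E h),
    mul (c *: s) t = c *: mul s t;
  fell_mulZr : forall g h (c : R[i]) (s : E g) (t : E h),
    mul s (c *: t) = c *: mul s t;
  fell_normM : forall g h (s : E g) (t : E h), `|mul s t| <= `|s| * `|t|;
  fell_starD : forall g (s s' : E g), star (s + s') = star s + star s';
  fell_starZ : forall g (c : R[i]) (s : E g), star (c *: s) = Num.conj c *: star s;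
  fell_starM : forall x y, totalStar (totalMul x y) = totalMul (totalStar y) (totalStar x);
  fell_starK : involutive totalStar;
  fell_cstar : forall g (s : E g), `|mul (star s) s| = `|s| ^+ 2;
  fell_pos : forall x : {g & E g}, exists b : E 1%g,
    totalMul (totalStar x) x = totalMul (totalStar (existT _ 1%g b)) (existT _ 1%g b)
}.

Definition saturated : Prop := forall g h,
  dense (lspan [set r : E (g * h)%g | exists s t, r = mul s t]).

End FellBundle.

Section FactorSystemBundle.
Variables (R : realType) (G : groupType) (B : cstarAlgType R).
Variables (tp : tensorProduct B) (psi : G -> Pic B) (F : factorSystem tp psi).

Definition fs_mul g h (s : F g) (t : F h) : F (g * h)%g :=
  fs_iso F g h (tens (tp (F g) (F h)) s t).

Definition fs_lambda g (s : F g) (t : F g^-1%g) : regularBimod B :=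
  iso_of_eq (fs_unit F) (iso_of_eq (congr1 F (mulgV g)) (fs_mul s t)).

Definition fs_star g (s : F g) : F g^-1%g := adjoint (fs_lambda s) (1 : B).

End FactorSystemBundle.

(* Main.v *)
Require Import Defs.
From mathcomp Require Import all_boot all_order all_algebra.
From mathcomp Require Import all_classical all_reals all_analysis.
From mathcomp Require Import complex.

Set Implicit Arguments.
Unset Strict Implicit.
Unset Printing Implicit Defensive.

Import Order.TTheory GRing.Theory Num.Theory.
Import numFieldNormedType.Exports.

(** A bimodule isometry knows everything about the product.  Write e for the
unit of G, and regard B_e as B.

The unit acts correctly: t |-> 1.t preserves inner products, hence is
injective, and it is idempotent because 1.1 = 1; so it is the identity, and
multiplication by elements of B_e is the bimodule action ([mul_lact],
[mul_ract]).

The involution is determined by <s^*, t>_B = s t for t in B_{g^-1}; such an s^*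
exists because 1 is a finite sum of left inner products <x_i, y_i>, so that
every right B-linear map f into B satisfies f(t) = sum f(x_i) <y_i, t>_B
([rip_representation]).  As Psi_{g,g^-1} is isometric for both inner products,
computing the inner products of two elements s t, s' t' of B exhibits s |-> s^*
as an anti-isometry exchanging left and right inner products ([lip_star],
[star_rip]).  Hence s t^* = <s, t> on the left; then
r (s^* t) = (r s^* ) t = <r, s> t = r <s, t>_B for all r, and the right action
is faithful, so s^* t = <s, t>_B ([star_mul_self]).  From this follow s^** = s,
the C*-identity and the positivity of s^* s, while (s t)^* = t^* s^* is tested
against products, which span.

The only analytic point is |s t| <= |s| |t|, that is, |b t| <= |b| |t| for the
left action of B on B_h.  A self-adjoint a with |a| < 1 is the mean of the
unitaries a +- i sqrt(1 - a^2), and unitaries of B act isometrically, so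
self-adjoint elements act contractively ([lact_selfadj_norm]).  With
p = <x, x> on the left and q = <x, x>_B we have p x = x q, hence
q^3 = <p x, p x>_B and |q|^4 <= |p|^2 |q|^2, that is, |q| <= |p|
([rip_norm_le_lip]).  The involution exchanges p and q, so |p| = |q|; and for
the left inner product the estimate <b x, b x> = b <x, x> b^* is immediate. *)

(** * Fixed points of contractions of a ball *)

Section ComplexValuedNorm.
Local Open Scope classical_set_scope.
Local Open Scope ring_scope.
Local Open Scope complex_scope.
Variables (R : realType).

(** Taking the slack to be real makes x and y comparable, which the partial
order of the complex numbers does not give for free. *)
Lemma lec_addgt0P (x y : R[i]) :
  (forall e : R, 0 < e -> x <= y + e%:C) -> x <= y.
Proof.
case: x y => [x x'] [y y'] h.
have := h 1 ltr01; rewrite !lecE /= addr0 => /andP[-> _] /=.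
by apply/ler_addgt0Pr => e /h; rewrite lecE /= => /andP[].
Qed.

(** The Banach fixed point theorem for a complex Banach space, on the closed
ball of radius r: the iterates of 0 have geometrically small increments. *)
Lemma contraction_fixed_point (V : completeNormedModType R[i]) (f : V -> V)
    (k : R) (r : R[i]) :
  0 <= k -> k < 1 -> 0 <= r ->
  (forall x, `|x| <= r -> `|f x| <= r) ->
  (forall x y, `|x| <= r -> `|y| <= r -> `|f x - f y| <= k%:C * `|x - y|) ->
  exists2 x, `|x| <= r & f x = x.
Proof.
move=> k0 k1 r0 fr fk; pose x n := iter n f 0; pose u n := x n.+1 - x n.
have xr n : `|x n| <= r by elim: n => [|n /fr//]; rewrite normr0.
have [d d0 dE] := complex_ge0_ex (normr_ge0 (u 0)).
have uk n : `|u n| <= (d * k ^+ n)%:C.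
  elim: n => [|n IH]; first by rewrite expr0 mulr1 dE.
  apply: (le_trans (fk _ _ (xr n.+1) (xr n))).
  apply: (@le_trans _ _ (k%:C * (d * k ^+ n)%:C)).
    by apply: ler_wpM2l => //; rewrite lecR.
  by rewrite -rmorphM lecR exprS mulrCA.
have su n : series u n = x n by rewrite seriesEnat /= telescope_sumr// subr0.
have ck : `|k| < 1 by rewrite ger0_norm.
have small (e : R[i]) : 0 < e -> exists2 d : R, 0 < d & e = d%:C.
  move=> e0; have [c _ ec] := complex_ge0_ex (ltW e0).
  by exists c => //; rewrite -ltcR -ec.
have cx : cvgn x.
  rewrite -(_ : series u = x); last exact/funext.
  apply/cauchy_cvgP/cauchy_seriesP => e /small[c c0 ->].
  have /cauchy_cvgP/cauchy_seriesP/(_ _ c0) := @is_cvg_geometric_series R d k ck.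
  apply: filterS => n; rewrite -ltcR; apply: le_lt_trans.
  apply: (le_trans (ler_norm_sum _ _ _)).
  rewrite ger0_norm; last by apply: sumr_ge0 => i _; rewrite /= mulr_ge0 ?exprn_ge0.
  by rewrite rmorph_sum /=; apply: ler_sum => i _; exact: uk.
set l := limn x in cx.
have near (e : R) : 0 < e -> exists n, `|l - x n| <= e%:C /\ `|l - x n.+1| <= e%:C.
  rewrite -ltcR => e0.
  have xl : x @ \oo --> l by [].
  have /cvgrPdist_lt/(_ _ e0) [n _ h] := xl.
  by exists n; split; apply/ltW/h => //=.
have lr : `|l| <= r.
  apply: lec_addgt0P => e /near[n [ln _]].
  rewrite -[l](subrK (x n)) addrC; apply: (le_trans (ler_normD _ _)).
  exact: lerD.
exists l => //; apply/eqP; rewrite -subr_eq0 -normr_le0.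
apply: lec_addgt0P => e e0; have [n [ln lSn]] := near (e / 2) (divr_gt0 e0 (ltr0Sn _ 1)).
rewrite add0r -[f l](subrK (x n.+1)) -addrA.
apply: (le_trans (ler_normD _ _)).
rewrite (splitr e) rmorphD /= lerD//; last by rewrite distrC.
rewrite distrC; apply: (le_trans (fk _ _ (xr n) lr)).
rewrite distrC; apply: le_trans ln; rewrite ler_piMl//.
by rewrite -[1]/(1%:C) lecR ltW.
Qed.

End ComplexValuedNorm.

(** * Unitaries from square roots *)

Section CStarUnitary.
Local Open Scope ring_scope.
Local Open Scope complex_scope.
Variables (R : realType) (B : cstarAlgType R).
Implicit Types a b c u y z : B.

Lemma cnorm_adj a : `|cadj a| = `|a|.
Proof.
have le b : `|b| <= `|cadj b|.
  have [->|b0] := eqVneq b 0; first by rewrite cadj0.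
  have nb : 0 < `|b| by rewrite normr_gt0.
  by rewrite -(ler_pM2r nb) -expr2 -cstarE cnormM.
by apply/eqP; rewrite eq_le le -{2}[a]cadjK le.
Qed.

(** The uniqueness principle behind [selfadj_sqrt_subr]: both the difference of
two solutions z of z = (y + z^2) / 2 and the commutator of such a z with an
element commuting with y satisfy this homogeneous equation. *)
Lemma mean_contraction_eq0 (k : R[i]) b z w : k < 1 -> `|z| <= k -> `|w| <= k ->
  b = 2^-1 *: (z * b + b * w) -> b = 0.
Proof.
move=> k1 zk wk bE; apply/eqP/contraT => b0.
have nb : 0 < `|b| by rewrite normr_gt0.
suff : `|b| < `|b| by rewrite ltxx.
rewrite {1}bE normrZ normfV normr_nat ltr_pdivrMl//.
apply: (@le_lt_trans _ _ (k * `|b| + `|b| * k)).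
  apply: (le_trans (ler_normD _ _)); apply: lerD.
    by apply: (le_trans (cnormM _ _)); apply: ler_wpM2r.
  by apply: (le_trans (cnormM _ _)); apply: ler_wpM2l.
rewrite [`|b| * k]mulrC -mulr2n -[X in X < _]mulr_natl.
by rewrite ltr_pM2l ?ltr0n// gtr_pMl.
Qed.

(** The square root of 1 - y is 1 - z, where z = (y + z^2) / 2; the map on the
right is a contraction of the ball of radius |y|.  The remaining properties of
z come from uniqueness, without continuity of the involution. *)
Lemma selfadj_sqrt_subr y : cadj y = y -> `|y| < 1 ->
  exists c, [/\ cadj c = c, c * c = 1 - y & forall b, b * y = y * b -> b * c = c * b].
Proof.
move=> yA y1; have [k k0 yk] := complex_ge0_ex (normr_ge0 y).
have k1 : k < 1 by rewrite -ltcR -yk.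
have kC0 : 0 <= k%:C by rewrite -yk.
have h0 : 0 <= 2^-1 :> R[i] by rewrite invr_ge0 ler0n.
have n2 (b : B) : `|2^-1 *: b| = 2^-1 * `|b| by rewrite normrZ ger0_norm.
have mean (b b' : B) (d : R[i]) : `|b| <= d -> `|b'| <= d -> `|2^-1 *: (b + b')| <= d.
  move=> bd bd'; rewrite n2 ler_pdivrMl ?ltr0n// mulr_natl mulr2n.
  by apply: (le_trans (ler_normD _ _)); exact: lerD.
pose f z : B := 2^-1 *: (y + z * z).
have subf z w : z * z - w * w = z * (z - w) + (z - w) * w.
  by rewrite mulrBr mulrBl addrA subrK.
have [z zk zf] : exists2 z : B, `|z| <= k%:C & f z = z.
  apply: (contraction_fixed_point (k := k)) => //.
    move=> z zk; apply: mean; first by rewrite yk.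
    apply: (le_trans (cnormM _ _)); apply: (le_trans _ zk); rewrite ler_piMl//.
    by apply: ltW; apply: le_lt_trans zk _; rewrite -yk.
  move=> z w zk wk; rewrite /f -scalerBr opprD addrACA subrr add0r subf.
  apply: mean; apply: (le_trans (cnormM _ _)); first exact: ler_wpM2r.
  by rewrite mulrC; exact: ler_wpM2r.
have kC1 : k%:C < 1 :> R[i] by rewrite -yk.
have zE : z = 2^-1 *: (y + z * z) by rewrite -[LHS]zf.
have zA : cadj z = z.
  apply/eqP; rewrite -subr_eq0; apply/eqP.
  apply: (@mean_contraction_eq0 k%:C _ (cadj z) z) => //; first by rewrite cnorm_adj.
  rewrite -subf {1 2}zE cadjZ cadjD cadjM yA fmorphV rmorph_nat -scalerBr.
  by rewrite opprD addrACA subrr add0r.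
exists (1 - z); split.
- by rewrite cadjD -[- z]scaleN1r cadjZ rmorphN1 cadj1 zA.
- have : 2 *: z = y + z * z by rewrite {1}zE scalerA mulfV ?scale1r// pnatr_eq0.
  rewrite scaler_nat mulr2n => zz.
  have -> : y = z + z - z * z by rewrite zz addrK.
  by rewrite mulrBr mulr1 mulrBl mul1r -addrA -opprD addrA.
move=> b bc; rewrite mulrBr mulrBl mulr1 mul1r; congr (_ - _).
apply/eqP; rewrite -subr_eq0; apply/eqP.
apply: (@mean_contraction_eq0 k%:C _ z z) => //.
rewrite {1 2}zE -cscaleAr -cscaleAl -scalerBr mulrDr mulrDl bc opprD addrACA subrr add0r.
by congr (_ *: _); rewrite mulrBr mulrBl !mulrA [RHS]addrC [RHS]addrA subrK.
Qed.

(** The unitary is u = a + i sqrt(1 - a^2). *)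
Lemma selfadj_mean_unitary a : cadj a = a -> `|a| < 1 ->
  exists u, [/\ cadj u * u = 1, u * cadj u = 1 & a = 2^-1 *: (u + cadj u)].
Proof.
move=> aA a1.
have aaA : cadj (a * a) = a * a by rewrite cadjM aA.
have aa1 : `|a * a| < 1.
  by rewrite -{1}aA cstarE expr2 mulr_ilt1.
have [c [cA cc com]] := selfadj_sqrt_subr aaA aa1.
have ac : a * c = c * a by apply: com; rewrite mulrA.
have iA : Num.conj ('i%R : R[i]) = - 'i%R by exact: conjCi.
have ii : - ('i%R * 'i%R) = 1 :> R[i] by rewrite -expr2 sqrCi opprK.
set i := 'i%R in iA ii.
set d := i *: c.
have uA : cadj (a + d) = a - d by rewrite cadjD cadjZ aA cA iA scaleNr.
have ad : a * d = d * a by rewrite -cscaleAr -cscaleAl ac.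
have dd : d * d = a * a - 1.
  rewrite -cscaleAl -cscaleAr scalerA -[i * i]opprK ii scaleN1r cc.
  by rewrite opprB.
exists (a + d); rewrite uA; split.
- by rewrite mulrBl !mulrDr ad dd addrKA subKr.
- by rewrite mulrBr !mulrDl ad dd addrKA subKr.
- by rewrite addrACA subrr addr0 -mulr2n -[a *+ 2]scaler_nat scalerA mulVf ?scale1r// pnatr_eq0.
Qed.

End CStarUnitary.

(** * Norm estimates for the left action *)

Section ActionNorm.
Local Open Scope ring_scope.
Local Open Scope complex_scope.
Variables (R : realType) (B : cstarAlgType R).
Implicit Types M N : moritaBimod B.

Lemma eq_rip_norm M N (x : M) (y : N) : rip x x = rip y y -> `|x| = `|y|.
Proof.
move=> xy; apply/eqP; rewrite -(@eqrXn2 _ 2)// !rip_norm.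
by rewrite xy.
Qed.

Lemma lact_unitary_norm M (u : B) (x : M) : cadj u * u = 1 -> `|lact u x| = `|x|.
Proof. by move=> u1; apply: eq_rip_norm; rewrite rip_lact -lactM u1 lact1. Qed.

(** Rescaled to norm less than 1, a is a mean of two unitaries, which act
isometrically. *)
Lemma lact_selfadj_norm M (a : B) (x : M) : cadj a = a -> `|lact a x| <= `|a| * `|x|.
Proof.
move=> aA.
have small (b : B) : cadj b = b -> `|b| < 1 -> `|lact b x| <= `|x|.
  move=> bA b1; have [u [u1 u1' ->]] := selfadj_mean_unitary bA b1.
  rewrite lactZl lactDl normrZ normfV normr_nat ler_pdivrMl ?ltr0n//.
  apply: (le_trans (ler_normD _ _)).
  by rewrite !lact_unitary_norm ?cadjK// -mulr2n mulr_natl.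
have [->|x0] := eqVneq x 0.
  by rewrite -(scale0r (0 : M)) lactZr !scale0r !normr0 mulr0.
have nx : 0 < `|x| by rewrite normr_gt0.
rewrite -ler_pdivrMr//; apply: lec_addgt0P => e e0.
have eC0 : 0 < e%:C by rewrite ltcR.
set r := `|a| + e%:C; have r0 : 0 < r by apply: ltr_wpDl.
have rR : Num.conj r^-1 = r^-1 by apply: CrealP; rewrite gtr0_real ?invr_gt0.
rewrite ler_pdivrMr// -ler_pdivrMl//.
have -> : r^-1 * `|lact a x| = `|lact (r^-1 *: a) x|.
  by rewrite lactZl normrZ gtr0_norm// invr_gt0.
apply: small; first by rewrite cadjZ rR aA.
rewrite normrZ gtr0_norm ?invr_gt0// mulrC ltr_pdivrMr// mul1r.
by rewrite /r ltrDl.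
Qed.

(** For q = rip x x and p = lip x x, the relation p x = x q gives
q^3 = rip (p x) (p x), hence |q|^4 <= |q| |q^3| <= |q|^2 |p|^2. *)
Lemma rip_norm_le_lip M (x : M) : `|rip x x| <= `|lip x x|.
Proof.
set q := rip x x; set p := lip x x.
have qA : cadj q = q by rewrite /q rip_adj.
have pA : cadj p = p by rewrite /p lip_adj.
have [->|q0] := eqVneq q 0; first by rewrite normr0.
have nq : 0 < `|q| by rewrite normr_gt0.
have px : lact p x = ract x q by exact: lip_rip.
have q3 : rip (lact p x) (lact p x) = q * q * q.
  by rewrite px rip_ract rip_ractl qA.
have n3 : `|q * q * q| <= `|p| ^+ 2 * `|q|.
  rewrite -q3 -rip_norm -[`|q|]rip_norm -exprMn.
  by rewrite ler_pXn2r ?nnegrE ?mulr_ge0// lact_selfadj_norm.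
have n4 : `|q| ^+ 4 = `|q * q * q * q|.
  by rewrite (exprM _ 2 2) -(cstarE q) -cstarE cadjM !qA !mulrA.
suff: `|q| ^+ 2 <= `|p| ^+ 2 by rewrite ler_pXn2r ?nnegrE.
rewrite -(@ler_pM2r _ (`|q| ^+ 2)) ?exprn_gt0//.
rewrite -exprD n4; apply: (le_trans (cnormM _ _)).
by rewrite [`|q| ^+ 2]expr2 mulrA ler_wpM2r.
Qed.

End ActionNorm.

(** * Inner products, functionals and faithful actions *)

Section BimoduleDuality.
Local Open Scope classical_set_scope.
Local Open Scope ring_scope.
Local Open Scope complex_scope.
Variables (R : realType) (B : cstarAlgType R).
Implicit Types M : moritaBimod B.

(** Once the two inner products of x have equal norm, the bound can be computed
with the left one, where it is the submultiplicativity of B. *)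
Lemma lact_norm M (b : B) (x : M) :
  `|lip x x| <= `|rip x x| -> `|lact b x| <= `|b| * `|x|.
Proof.
move=> lr; suff: `|lact b x| ^+ 2 <= (`|b| * `|x|) ^+ 2.
  by rewrite ler_pXn2r ?nnegrE ?mulr_ge0.
rewrite rip_norm exprMn rip_norm; apply: (le_trans (rip_norm_le_lip _)).
rewrite lip_lact -lip_adj lip_lact cadjM lip_adj.
apply: (le_trans (cnormM _ _)); rewrite expr2 -mulrA ler_wpM2l//.
apply: (le_trans (cnormM _ _)); rewrite cnorm_adj mulrC.
exact: ler_wpM2l.
Qed.

(** Density of the ideal of right inner products already puts 1 in it, as
elements of B near 1 are invertible. *)
Lemma rip_full1 M : lspan [set b | exists x y : M, b = rip x y] 1.
Proof.
apply: dense_ideal1; last exact: rip_full.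
by move=> a _ [x [y ->]]; exists (ract x (cadj a)), y; rewrite rip_ractl cadjK.
Qed.

Lemma rip_inj M (x y : M) : (forall z, rip x z = rip y z) -> x = y.
Proof.
move=> h; apply/eqP; rewrite -subr_eq0; apply/eqP/rip_eq0.
by rewrite ripDl -scaleN1r ripZl rmorphN1 !scaleN1r h subrr.
Qed.

Lemma lact_faithful M (a b : B) : (forall x : M, lact a x = lact b x) -> a = b.
Proof.
move=> ab; rewrite -[a]mulr1 -[b]mulr1.
apply: (lspan_ind (P := fun c => a * c = b * c)) (lip_full1 M).
- by rewrite !mulr0.
- by move=> x y xE yE; rewrite !mulrDr xE yE.
- by move=> c _ [x [y ->]]; rewrite -!cscaleAr -!lip_lact ab.
Qed.

Lemma ract_faithful M (a b : B) : (forall x : M, ract x a = ract x b) -> a = b.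
Proof.
move=> ab; rewrite -[a]mul1r -[b]mul1r.
apply: (lspan_ind (P := fun c : B => c * a = c * b)) (rip_full1 M).
- by rewrite !mul0r.
- by move=> x y xE yE; rewrite !mulrDl xE yE.
- by move=> c _ [x [y ->]]; rewrite -!cscaleAl -!rip_ract ab.
Qed.

(** A Riesz lemma for right B-linear maps, purely algebraic because B has a
unit: if 1 is the sum of the
lip x_i y_i then f(x) is the sum of the f(x_i) rip y_i x, so f is represented by
the sum of the y_i f(x_i)^*. *)
Lemma rip_representation M (f : M -> B) :
  {morph f : x y / x + y} -> (forall x b, f (ract x b) = f x * b) ->
  exists z, forall x, f x = rip z x.
Proof.
move=> fD fract.
have f0 : f 0 = 0 by apply: (addrI (f 0)); rewrite -fD !addr0.
have fZ (c : R[i]) x : f (c *: x) = c *: f x.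
  by rewrite -[X in c *: X]ract1 -ractZr fract -cscaleAr mulr1.
suff [z zE] : exists z, forall x : M, f (lact 1 x) = rip z x.
  by exists z => x; rewrite -zE lact1.
apply: (lspan_ind (P := fun a => exists z, forall x : M, f (lact a x) = rip z x))
  (lip_full1 M).
- by exists (0 *: (0 : M)) => x; rewrite -(scale0r 0) lactZl ripZl rmorph0 !scale0r f0.
- by move=> a b [z zE] [w wE]; exists (z + w) => x; rewrite lactDl fD zE wE ripDl.
(* lip y w acts as x |-> y <w, x>_B, so f takes the value f(y) <w, x>_B. *)
move=> c _ [y [w ->]]; exists (Num.conj c *: ract w (cadj (f y))) => x.
by rewrite lactZl fZ lip_rip fract ripZl conjCK rip_ractl cadjK.
Qed.

Lemma iso_norm M N (f : bimodIso M N) (x : M) : `|f x| = `|x|.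
Proof. by apply: eq_rip_norm; rewrite iso_rip. Qed.

Lemma iso_inj M N (f : bimodIso M N) : injective f.
Proof. exact: bij_inj (iso_bij f). Qed.

Lemma iso_of_eqK M N (e : M = N) : cancel (iso_of_eq (esym e)) (iso_of_eq e).
Proof. by case: _ / e. Qed.

Lemma rip_regular (a b : B) : rip (a : regularBimod B) b = cadj a * b.
Proof. by []. Qed.

Lemma lip_regular (a b : B) : lip (a : regularBimod B) b = a * cadj b.
Proof. by []. Qed.

End BimoduleDuality.

(** * The multiplication of a factor system *)

Section FactorSystemAlgebra.
Local Open Scope classical_set_scope.
Local Open Scope ring_scope.
Local Open Scope complex_scope.
Variables (R : realType) (G : groupType) (B : cstarAlgType R).
Variables (tp : tensorProduct B) (psi : G -> Pic B) (F : factorSystem tp psi).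
Implicit Types g h k : G.

Local Notation tot x := (existT (fun g => F g : Type) _ x).
Local Notation mul := (fs_mul (F := F)).
Local Notation star := (fs_star (F := F)).
Local Notation tmul := (totalMul (fs_mul (F := F))).

(** Equalities such as g (h k) = (g h) k are transported by isomorphisms, or
avoided altogether by comparing elements in the total space through [tot]. *)
Definition fs_cast g h (e : g = h) : bimodIso (F g) (F h) := iso_of_eq (congr1 F e).

(** Products such as s s^* lie over g g^-1, which is the unit of G only up to a
proof [e]; this identifies the fiber over such an expression with B. *)
Definition fs_toB g (e : g = 1%g) : bimodIso (F g) (regularBimod B) :=
  iso_comp (iso_of_eq (fs_unit F)) (iso_of_eq (congr1 F e)).

Definition fs_one : F 1%g := iso_of_eq (esym (fs_unit F)) (1 : B).

Lemma tot_cast g h (e : g = h) (x : F g) : tot (fs_cast e x) = tot x.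
Proof. by case: _ / e. Qed.

Lemma tot_inj g (x y : F g) : tot x = tot y -> x = y.
Proof. exact: eq_from_Tagged. Qed.

Lemma tot_toB g h (x : F g) (y : F h) (e : g = 1%g) (e' : h = 1%g) :
  tot x = tot y -> fs_toB e x = fs_toB e' y.
Proof.
move=> xy; have gh : g = h := congr1 (@projT1 _ _) xy.
by case: _ / gh in y e' xy *; rewrite (tot_inj xy) (Prop_irrelevance e e').
Qed.

Lemma toB_tot g h (x : F g) (y : F h) (e : g = 1%g) (e' : h = 1%g) :
  fs_toB e x = fs_toB e' y -> tot x = tot y.
Proof.
subst g; subst h => xy; congr existT; exact: iso_inj xy.
Qed.

Lemma toB_one : fs_toB erefl fs_one = 1 :> B.
Proof. exact: (iso_of_eqK (fs_unit F) (1 : B)). Qed.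

Lemma fs_mulDl g h (s s' : F g) (t : F h) : mul (s + s') t = mul s t + mul s' t.
Proof. by rewrite /fs_mul tensDl isoD. Qed.

Lemma fs_mulDr g h (s : F g) (t t' : F h) : mul s (t + t') = mul s t + mul s t'.
Proof. by rewrite /fs_mul tensDr isoD. Qed.

Lemma fs_mulZl g h (c : R[i]) (s : F g) (t : F h) : mul (c *: s) t = c *: mul s t.
Proof. by rewrite /fs_mul tensZl isoZ. Qed.

Lemma fs_mulZr g h (c : R[i]) (s : F g) (t : F h) : mul s (c *: t) = c *: mul s t.
Proof. by rewrite /fs_mul tensZr isoZ. Qed.

Lemma fs_mul_lact g h b (s : F g) (t : F h) : mul (lact b s) t = lact b (mul s t).
Proof. by rewrite /fs_mul -tens_lact iso_lact. Qed.

Lemma fs_mul_ract g h b (s : F g) (t : F h) : mul s (ract t b) = ract (mul s t) b.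
Proof. by rewrite /fs_mul -tens_ract iso_ract. Qed.

Lemma fs_mul_rip g h (s s' : F g) (t t' : F h) :
  rip (mul s t) (mul s' t') = rip t (lact (rip s s') t').
Proof. by rewrite iso_rip tens_rip. Qed.

Lemma fs_mul_lip g h (s s' : F g) (t t' : F h) :
  lip (mul s t) (mul s' t') = lip (ract s (lip t t')) s'.
Proof. by rewrite iso_lip tens_lip. Qed.

Lemma fs_mul_span g h :
  lspan [set r : F (g * h)%g | exists s t, r = mul s t] = setT.
Proof.
apply/seteqP; split=> // r _; have [f _ fK] := iso_bij (fs_iso F g h).
rewrite -[r]fK; have: lspan [set z | exists x y, z = tens (tp (F g) (F h)) x y] (f r).
  by rewrite lspan_tens.
apply: lspan_map; [exact: isoD|exact: isoZ|].
by move=> _ [s [t ->]]; apply: lspan_id; exists s, t.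
Qed.

Lemma tmulA : associative tmul.
Proof.
move=> [g s] [h t] [k r]; rewrite /totalMul /=.
have := fs_cocycle (tens (tp (tp (F g) (F h)) (F k)) (tens (tp (F g) (F h)) s t) r).
rewrite tens_isoE tens_assocE tens_isoE /= => E.
by rewrite [X in _ = tot X]E -/(fs_cast _) tot_cast.
Qed.

Lemma toB_mul11 (s t : F 1%g) :
  fs_toB (mul1g 1%g) (mul s t) = (fs_toB erefl s : B) * fs_toB erefl t.
Proof.
have := fs_iso11 (tens (tp (F 1%g) (F 1%g)) s t).
by rewrite tens_isoE tens_unitE.
Qed.

Lemma tot_one : tmul (tot fs_one) (tot fs_one) = tot fs_one.
Proof.
apply: (@toB_tot _ _ _ _ (mul1g 1%g) erefl).
by rewrite toB_mul11 toB_one mulr1.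
Qed.

Lemma lact_one (s : F 1%g) : s = lact (fs_toB erefl s : B) fs_one.
Proof.
apply: (iso_inj (f := fs_toB erefl)).
by rewrite iso_lact toB_one /= mulr1.
Qed.

Lemma ract_one (s : F 1%g) : s = ract fs_one (fs_toB erefl s : B).
Proof.
apply: (iso_inj (f := fs_toB erefl)).
by rewrite iso_ract toB_one /= mul1r.
Qed.

(** x |-> 1 x preserves right inner products, hence is injective, and is
idempotent; so it is the identity. *)
Lemma mul_one_l h (t : F h) : tot (mul fs_one t) = tot t.
Proof.
pose T (x : F h) : F h := fs_cast (mul1g h) (mul fs_one x).
have TE x : tot (T x) = tmul (tot fs_one) (tot x) by rewrite tot_cast.
have TT x : T (T x) = T x by apply: tot_inj; rewrite !TE tmulA tot_one.
have T0 x : T x = 0 -> x = 0.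
  move=> x0; apply: rip_eq0; have : rip (T x) (T x) = 0.
    by rewrite x0 -(scale0r 0) ripZr !scale0r.
  rewrite iso_rip fs_mul_rip -(iso_rip (fs_toB erefl)) toB_one /=.
  by rewrite cadj1 mulr1 lact1.
have TB x : T (T x - x) = 0.
  by rewrite /T fs_mulDr -scaleN1r fs_mulZr isoD isoZ scaleN1r -/(T _) -/(T _) TT subrr.
rewrite -[LHS]/(tmul (tot fs_one) (tot t)) -TE.
by congr existT; apply/eqP; rewrite -subr_eq0; apply/eqP/T0/TB.
Qed.

(** As for [mul_one_l], with the left inner product. *)
Lemma mul_one_r g (s : F g) : tot (mul s fs_one) = tot s.
Proof.
pose T (x : F g) : F g := fs_cast (mulg1 g) (mul x fs_one).
have TE x : tot (T x) = tmul (tot x) (tot fs_one) by rewrite tot_cast.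
have TT x : T (T x) = T x by apply: tot_inj; rewrite !TE -tmulA tot_one.
have T0 x : T x = 0 -> x = 0.
  move=> x0; apply: lip_eq0; have : lip (T x) (T x) = 0.
    by rewrite x0 -(scale0r 0) lipZl !scale0r.
  rewrite iso_lip fs_mul_lip -(iso_lip (fs_toB erefl)) toB_one /=.
  by rewrite cadj1 mulr1 ract1.
have TB x : T (T x - x) = 0.
  by rewrite /T fs_mulDl -scaleN1r fs_mulZl isoD isoZ scaleN1r -/(T _) -/(T _) TT subrr.
rewrite -[LHS]/(tmul (tot s) (tot fs_one)) -TE.
by congr existT; apply/eqP; rewrite -subr_eq0; apply/eqP/T0/TB.
Qed.

Lemma mul_lact g h (e : g = 1%g) (s : F g) (t : F h) :
  tot (mul s t) = tot (lact (fs_toB e s : B) t).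
Proof.
subst g; rewrite {1}[s]lact_one -[LHS](tot_cast (mul1g h)).
rewrite fs_mul_lact iso_lact; congr (tot (lact _ _)).
by apply: tot_inj; rewrite tot_cast mul_one_l.
Qed.

Lemma mul_ract g h (e : h = 1%g) (s : F g) (t : F h) :
  tot (mul s t) = tot (ract s (fs_toB e t : B)).
Proof.
subst h; rewrite {1}[t]ract_one -[LHS](tot_cast (mulg1 g)).
rewrite fs_mul_ract iso_ract; congr (tot (ract _ _)).
by apply: tot_inj; rewrite tot_cast mul_one_r.
Qed.

(** * The involution of a factor system *)

Lemma fs_lambda_representation g (s : F g) :
  exists z, forall t, fs_lambda s t = rip z t.
Proof.
apply: rip_representation => [x y|x b].
- by rewrite /fs_lambda fs_mulDr !isoD.
- by rewrite /fs_lambda fs_mul_ract !iso_ract.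
Qed.

Lemma adjointable_fs_lambda g (s : F g) : adjointable (fs_lambda s).
Proof.
have [z zE] := fs_lambda_representation s.
by exists (fun b => ract z b) => t b; rewrite zE rip_ract /= rip_adj.
Qed.

(** The defining property of the involution, free of adjoints: s^* represents
t |-> s t.  All algebraic properties of the star below are read off from it. *)
Lemma rip_star g (s : F g) (t : F g^-1%g) :
  rip (star s) t = fs_toB (mulgV g) (mul s t).
Proof.
have [z zE] := fs_lambda_representation s.
have zP x : rip (fs_lambda s x : regularBimod B) (1 : B) = rip x z.
  by rewrite zE /= mulr1 rip_adj.
(* The choice in [adjoint] returns some vector with the adjoint property as
   soon as there is one, namely z. *)
have adjP := xgetI (0 : F g^-1%g)
  (P := [set z | forall x, rip (fs_lambda s x : regularBimod B) (1 : B) = rip x z]) zP.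
by rewrite -rip_adj -adjP /= mulr1 cadjK.
Qed.

Lemma starP g (s : F g) (z : F g^-1%g) :
  (forall t, rip z t = fs_toB (mulgV g) (mul s t)) -> star s = z.
Proof. by move=> zE; apply: rip_inj => t; rewrite rip_star zE. Qed.

Lemma fs_starD g (s s' : F g) : star (s + s') = star s + star s'.
Proof. by apply: starP => t; rewrite ripDl !rip_star fs_mulDl isoD. Qed.

Lemma fs_starZ g (c : R[i]) (s : F g) : star (c *: s) = Num.conj c *: star s.
Proof. by apply: starP => t; rewrite ripZl conjCK rip_star fs_mulZl isoZ. Qed.

(** Compare the two expressions of rip (s t) (s' t'): as an inner product of the
tensor product it is <t, <s, s'>_B t'>_B, and as (s t)^* (s' t') in B it is
<t, s^*>_B <s'^*, t'>_B. *)
Lemma lip_star g (s s' : F g) : lip (star s) (star s') = rip s s'.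
Proof.
apply: (lact_faithful (M := F g^-1%g)) => t'; apply: rip_inj => t.
rewrite -[LHS]rip_adj -[RHS]rip_adj; congr cadj.
rewrite -fs_mul_rip -(iso_rip (fs_toB (mulgV g))) rip_regular -!rip_star.
by rewrite lip_rip rip_ract rip_adj.
Qed.

(** The same comparison for lip (s t) (s' t') gives the identity multiplied by
any left inner product of t and t'; these span 1. *)
Lemma star_rip g (s s' : F g) : rip (star s) (star s') = lip s s'.
Proof.
suff : rip (star s) (lact (1 : B) (star s')) = lip (ract s (1 : B)) s'.
  by rewrite lact1 ract1.
apply: (lspan_ind
  (P := fun b : B => rip (star s) (lact b (star s')) = lip (ract s b) s'))
  (lip_full1 (F g^-1%g)).
- by rewrite -(scale0r 0) lactZl ractZr ripZr lipZl !scale0r.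
- by move=> a b aE bE; rewrite lactDl ractDr ripDr lipDl aE bE.
move=> c _ [t [t' ->]]; rewrite lactZl ractZr ripZr lipZl; congr (_ *: _).
rewrite -fs_mul_lip -(iso_lip (fs_toB (mulgV g))) lip_regular -!rip_star.
by rewrite lip_rip rip_ract rip_adj.
Qed.

Lemma mul_star_self g (s t : F g) : fs_toB (mulgV g) (mul s (star t)) = lip s t.
Proof. by rewrite -rip_star star_rip. Qed.

(** By associativity r (s^* t) = (r s^* ) t = <r, s> t = r <s, t>_B for all r
in the fiber of s, and the right action is faithful. *)
Lemma star_mul_self g (s t : F g) : fs_toB (mulVg g) (mul (star s) t) = rip s t.
Proof.
apply: (ract_faithful (M := F g)) => r; apply: tot_inj.
rewrite -mul_ract -[LHS]/(tmul (tot r) (tmul (tot (star s)) (tot t))) tmulA.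
by rewrite -[LHS]/(tot (mul (mul r (star s)) t)) (mul_lact (mulgV g)) mul_star_self lip_rip.
Qed.

Lemma tot_star_star g (s : F g) : tot (star (star s)) = tot s.
Proof.
rewrite -(tot_cast (esym (invgK g)) s); congr existT; apply: starP => t.
have sK : fs_cast (invgK g) (fs_cast (esym (invgK g)) s) = s.
  by apply: tot_inj; rewrite !tot_cast.
rewrite -(iso_rip (fs_cast (invgK g))) sK -star_mul_self.
apply: tot_toB.
by rewrite -[LHS]/(tmul (tot (star s)) (tot (fs_cast (invgK g) t))) tot_cast.
Qed.

(** Both sides have the same right inner product with a product t' s' in
B_{h^-1} B_{g^-1}, namely s ((t t') s'), and such products span. *)
Lemma fs_starM g h (s : F g) (t : F h) :
  tot (star (mul s t)) = tot (mul (star t) (star s)).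
Proof.
rewrite -(tot_cast (esym (invgM g h)) (mul (star t) (star s))).
congr existT; apply: starP => r.
have eK : cancel (fs_cast (invgM g h)) (fs_cast (esym (invgM g h))).
  by move=> x; apply: tot_inj; rewrite !tot_cast.
rewrite -[r]eK iso_rip.
have: lspan [set x | exists t' s', x = mul (t' : F h^-1%g) (s' : F g^-1%g)]
    (fs_cast (invgM g h) r) by rewrite fs_mul_span.
move: (fs_cast _ r); apply: (lspan_ind (P := fun x =>
  rip (mul (star t) (star s)) x =
  fs_toB (mulgV (g * h)%g) (mul (mul s t) (fs_cast (esym (invgM g h)) x)))).
- by rewrite -(scale0r 0) isoZ fs_mulZr isoZ ripZr !scale0r.
- by move=> x y xE yE; rewrite isoD fs_mulDr isoD ripDr xE yE.
move=> c _ [t' [s' ->]]; rewrite isoZ fs_mulZr isoZ ripZr; congr (_ *: _).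
rewrite fs_mul_rip !rip_star; apply: tot_toB.
rewrite -[LHS]/(tmul (tot s) (tot (lact (fs_toB (mulgV h) (mul t t') : B) s'))).
rewrite -mul_lact.
rewrite -[RHS]/(tmul (tmul (tot s) (tot t)) (tot (fs_cast (esym (invgM g h)) (mul t' s')))).
by rewrite tot_cast -tmulA -[tot (mul t' s')]/(tmul (tot t') (tot s')) [X in _ = tmul _ X]tmulA.
Qed.

(** The involution exchanges the two inner products, so the inequality proved
for s^* is the reverse one for s. *)
Lemma lip_norm_le_rip g (s : F g) : `|lip s s| <= `|rip s s|.
Proof. by rewrite -star_rip -[rip s s]lip_star rip_norm_le_lip. Qed.

(** If <s, s>_B = b^* b then s t has the norm of b t, and s that of b. *)
Lemma fs_normM g h (s : F g) (t : F h) : `|mul s t| <= `|s| * `|t|.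
Proof.
have [b bE] := rip_ge0 s.
have -> : `|mul s t| = `|lact b t|.
  by apply: eq_rip_norm; rewrite fs_mul_rip bE rip_lact lactM.
have -> : `|s| = `|b| by apply: (@eq_rip_norm _ _ (F g) (regularBimod B)).
exact/lact_norm/lip_norm_le_rip.
Qed.

Lemma fs_cstar g (s : F g) : `|mul (star s) s| = `|s| ^+ 2.
Proof. by rewrite -(iso_norm (fs_toB (mulVg g))) star_mul_self rip_norm. Qed.

Lemma fs_pos (x : {g & F g}) : exists b : F 1%g,
  tmul (totalStar (@fs_star _ _ _ _ _ F) x) x =
  tmul (totalStar (@fs_star _ _ _ _ _ F) (tot b)) (tot b).
Proof.
case: x => g s; have [b bE] := rip_ge0 s.
exists (ract fs_one b).
apply: (@toB_tot _ _ _ _ (mulVg g) (mulVg 1%g)).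
rewrite !star_mul_self -(iso_rip (fs_toB erefl)) iso_ract toB_one /= mul1r.
exact: bE.
Qed.

End FactorSystemAlgebra.

Theorem theorem3p4 (R : realType) (G : groupType) (B : cstarAlgType R)
    (tp : tensorProduct B) (psi : G -> Pic B) (psi_hom : isPicHom tp psi)
    (F : factorSystem tp psi) :
  (forall (g : G) (s : F g), adjointable (fs_lambda s)) /\
  isFellBundle (fs_mul (F := F)) (fs_star (F := F)) /\
  saturated (fs_mul (F := F)).
Proof.
split; first by move=> g s; exact: adjointable_fs_lambda.
split; last by move=> g h; apply/dense_setT/fs_mul_span.
split.
- exact: tmulA.
- exact: fs_mulDl.
- exact: fs_mulDr.
- exact: fs_mulZl.
- exact: fs_mulZr.
- exact: fs_normM.
- exact: fs_starD.
- exact: fs_starZ.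
- by move=> [g s] [h t]; exact: fs_starM.
- by move=> [g s]; exact: tot_star_star.
- exact: fs_cstar.
- exact: fs_pos.
Qed.
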